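(* Let $(G,X^* )$ be a contracting self-similar action with nucleus $\mathcal{N}$, limit $G$-space $\mathcal{X}_G$ with its measure $\mu$, and tile $\mathcal{T}\subset\mathcal{X}_G$. Then $\mu(\mathcal{T})$ is equal to the measure number $\mathrm{meas}(\Gamma_{\mathcal{N}})$ of the graph $\Gamma_{\mathcal{N}}$; in particular $\mu(\mathcal{T})$ is always an integer. Moreover, $\mu(\mathcal{T})=1$ if and only if the action satisfies the open set condition.
   Context: Let $X$ be a finite nonempty set, $X^*$ the set of finite words over $X$, and $X^{-\omega}$ the space of left-infinite sequences $\ldots x_2x_1$, $x_i\in X$, with the product topology. A faithful (left) action of a group $G$ on $X^*$ is self-similar if for every $g\in G$, $x\in X$ there exist $h\in G$, $y\in X$ such that $g(xw)=y\,h(w)$ for all $w\in X^*$; then $h$ is denoted $g|_x$, and $g|_{x_1\ldots x_n}=g|_{x_1}|_{x_2}\cdots|_{x_n}$. The action is contracting if there is a finite set $\mathcal{N}\subset G$ such that for every $g\in G$ there is $k$ with $g|_v\in\mathcal{N}$ for all words $v$ of length $\ge k$; the smallest such set $\mathcal{N}$ is the nucleus. The nucleus is regarded as a directed labeled graph with vertex set $\mathcal{N}$ and an edge from $g$ to $g|_x$ labeled $(x,g(x))$ for all $g\in\mathcal{N}$, $x\in X$. $\Gamma_{\mathcal{N}}$ is the graph obtained from it by replacing each label $(x,y)$ by $x$. Two elements $\ldots x_2x_1\cdot g$ and $\ldots y_2y_1\cdot h$ of $X^{-\omega}\times G$ ($G$ discrete) are asymptotically equivalent if there are a finite set $K\subset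 G$ and $g_n\in K$, $n\ge1$, with $g_n(x_n\ldots x_1)=y_n\ldots y_1$ and $g_n|_{x_n\ldots x_1}\cdot g=h$ for all $n\ge 1$. The limit $G$-space $\mathcal{X}_G$ is the quotient topological space of $X^{-\omega}\times G$ by this relation. The tile $\mathcal{T}$ is the image of $X^{-\omega}\times\{1\}$ in $\mathcal{X}_G$. The measure $\mu$ on $\mathcal{X}_G$ is the push-forward, under the quotient map, of the product of the uniform Bernoulli measure $\mu_u$ on $X^{-\omega}$ (each letter has weight $1/|X|$) and the counting measure on $G$. For a finite graph $\Gamma=(V,E)$ labeled by $X$ in which edges with a common starting vertex have different labels, $F_v\subseteq X^{-\omega}$ ($v\in V$) is the set of sequences $\ldots x_2x_1$ that label some left-infinite path $\ldots e_2e_1$ ending in $v$ ($e_i$ labeled $x_i$), and the measure number is $\mathrm{meas}(\Gamma)=\sum_{v\in V}\mu_u(F_v)$. The action satisfies the open set condition if for every $g\in\mathcal{N}$ there is a word $v\in X^*$ with $g|_v=1$. *)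

(* Defs.v *)
From HB Require Import structures.
From mathcomp Require Import all_boot all_order all_algebra finmap.
From mathcomp Require Import all_classical all_reals all_analysis.

Set Implicit Arguments.
Unset Strict Implicit.
Unset Printing Implicit Defensive.
Import Order.TTheory GRing.Theory Num.Theory.

Local Open Scope classical_set_scope.
Local Open Scope ring_scope.

(* A finite nonempty alphabet is a finite type with a distinguished point; the
   point only serves as a default value. *)
#[short(type="pfinType")]
HB.structure Definition PointedFinite := {T of Finite T & isPointed T}.

Section SelfSimilar.
Local Open Scope group_scope.

Record selfsim (G : groupType) (X : finType) := Selfsim {
  act :> G -> seq X -> seq X;
  act1 : forall w, act 1 w = w;
  actM : forall g h w, act (g * h) w = act g (act h w);
  act_faithful : forall g, (forall w, act g w = w) -> g = 1;
  act_selfsim : forall g x, exists h y, forall w, act g (x :: w) = y :: act h w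
}.

Variables (G : groupType) (X : finType) (a : selfsim G X).

(* g(x), read off from the action on words of length one. *)
Definition letter_act (g : G) (x : X) : X := head x (a g [:: x]).

(* g|_x: by act_selfsim such an h exists, by faithfulness it is unique (see
   lsection_unique), so the default value 1 is irrelevant. *)
Definition lsection (g : G) (x : X) : G :=
  xget 1 [set h | exists y, forall w, a g (x :: w) = y :: a h w].

(* g|_{x1 ... xn} = g|_x1 |_x2 ... |_xn, for the word [:: x1; ...; xn]. *)
Definition wsection (g : G) (v : seq X) : G := foldl lsection g v.

Definition attracting (N : set G) : Prop := finite_set N /\
  forall g, exists k, forall v, (k <= size v)%N -> N (wsection g v).

Definition contracting : Prop := exists N, attracting N.

Definition is_nucleus (N : set G) : Prop :=
  attracting N /\ forall N', attracting N' -> N `<=` N'.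

Definition open_set_condition (N : set G) : Prop :=
  forall g, N g -> exists v, wsection g v = 1.

Lemma act_nil g : a g [::] = [::].
Proof.
case E: (a g [::]) => [//|x w].
have := act_selfsim a g^-1 x => -[h [y H]].
have : a g^-1 (a g [::]) = [::] by rewrite -actM mulVg act1.
by rewrite E H.
Qed.

Lemma act_inj g h : (forall w, a g w = a h w) -> g = h.
Proof.
move=> gh; suff: h^-1 * g = 1 by move/(congr1 (fun z => h * z)); rewrite mulVKg mulg1.
by apply: (act_faithful (s := a)) => w; rewrite actM gh -actM mulVg act1.
Qed.

Lemma act_cons g x w : a g (x :: w) = letter_act g x :: a (lsection g x) w.
Proof.
have [h [y H]] := act_selfsim a g x.
have [y' H'] : [set h | exists y, forall w, a g (x :: w) = y :: a h w]
    (lsection g x).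
  by rewrite /lsection; apply: xgetPex; exists h, y.
by rewrite /letter_act !H' act_nil.
Qed.

Lemma lsection_unique g x h y :
  (forall w, a g (x :: w) = y :: a h w) -> lsection g x = h.
Proof. by move=> H; apply: act_inj => w; move: (H w); rewrite act_cons => -[]. Qed.

Lemma size_act g v : size (a g v) = size v.
Proof. by elim: v g => [|x v IH] g; rewrite ?act_nil// act_cons /= IH. Qed.

Lemma wsection1 v : wsection 1 v = 1.
Proof.
rewrite /wsection; elim: v => //= x v IH.
by rewrite (@lsection_unique 1 x 1 x)// => w; rewrite !act1.
Qed.

Lemma wsection_rcons g v x : wsection g (rcons v x) = lsection (wsection g v) x.
Proof. by rewrite /wsection -cats1 foldl_cat. Qed.

Lemma wsectionM g h v : wsection (g * h) v = wsection g (a h v) * wsection h v.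
Proof.
elim: v g h => [|x v IH] g h; first by rewrite act_nil.
rewrite [LHS]/= act_cons /= -IH; congr (foldl _ _ _).
apply: (@lsection_unique _ _ _ (letter_act g (letter_act h x))) => w.
by rewrite !actM !act_cons.
Qed.

Lemma wsectionV g v : wsection g^-1 (a g v) = (wsection g v)^-1.
Proof.
rewrite -[LHS](mulgK (wsection g v)) -wsectionM mulVg wsection1 mul1g //.
Qed.

Lemma attractingI N N' : attracting N -> attracting N' -> attracting (N `&` N').
Proof.
move=> [fN aN] [_ aN']; split; first exact: finite_setIl.
move=> g; have [k K] := aN g; have [k' K'] := aN' g.
exists (maxn k k') => v; rewrite geq_max => /andP[? ?].
by split; [exact: K|exact: K'].
Qed.

Lemma nucleus_exists : contracting -> exists N, is_nucleus N.
Proof.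
move=> [N0 aN0].
have ex : exists n, `[< exists2 N, attracting N & #|` fset_set N| = n >].
  by exists #|` fset_set N0|; apply/asboolP; exists N0.
case: (ex_minnP ex) => n /asboolP[N aN Nn] nmin.
exists N; split=> // N' aN'.
have aI := attractingI aN aN'.
have nm : (n <= #|` fset_set (N `&` N')|)%N.
  by apply: nmin; apply/asboolP; exists (N `&` N').
have sub : (fset_set (N `&` N') `<=` fset_set N)%fset.
  by rewrite -fset_set_sub; [exact: subIsetl|exact: aI.1|exact: aN.1].
have /(fset_set_inj aI.1 aN.1) <- : fset_set (N `&` N') = fset_set N.
  by apply/eqP; rewrite eqEfcard sub Nn.
exact: subIsetr.
Qed.

Lemma nucleus_lsection N g x : is_nucleus N -> N g -> N (lsection g x).
Proof.
move=> [aN minN] Ng; apply: contrapT => Ngx.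
suff aNg : attracting (N `\ g) by have [_] := minN _ aNg _ Ng; apply.
split; first exact: (finite_setD _ aN.1).
move=> h; have [k K] := aN.2 h; exists k => v kv; split; first exact: K.
move=> /= vg; apply: Ngx; rewrite -vg -wsection_rcons; apply: K.
by rewrite size_rcons leqW.
Qed.

End SelfSimilar.

Definition borel (T : ptopologicalType) : Type := g_sigma_algebraType (@open T).
HB.instance Definition _ (T : ptopologicalType) := Measurable.on (borel T).

Section LeftInfinite.
Variable X : pfinType.

(* A left-infinite sequence ... x_2 x_1 is the function w with
   w i = x_(i + 1), so that w 0 is its last letter. *)
Definition lseq : Type := prod_topology (fun _ : nat => discrete_topology X).
HB.instance Definition _ := Pointed.on lseq.
HB.instance Definition _ := Nbhs.on lseq.
HB.instance Definition _ := Topological.on lseq.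
HB.instance Definition _ := Uniform.on lseq.

(* The finite word x_n ... x_1. *)
Definition lword (w : lseq) (n : nat) : seq X := rev (mkseq w n).

(* The sequences ... x_2 x_1 that end in the word v. *)
Definition cyl (v : seq X) : set lseq := [set w | lword w (size v) = v].

Definition uniform_bernoulli (R : realType) (m : set (borel lseq) -> \bar R) :=
  forall v : seq X, m (cyl v) = (#|X|%:R ^- size v)%:E.

Lemma mkseqS (T : Type) (f : nat -> T) n : mkseq f n.+1 = rcons (mkseq f n) (f n).
Proof. by rewrite /mkseq -addn1 iotaD map_cat cats1. Qed.

Lemma lword_eqP (w w' : lseq) n :
  lword w n = lword w' n <-> forall i, (i < n)%N -> w i = w' i.
Proof.
split=> [/(can_inj revK) ww' i ni|ww'].
  by have := congr1 (nth point ^~ i) ww'; rewrite !nth_mkseq.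
congr rev; apply: (@eq_from_nth _ point); rewrite !size_mkseq// => i ni.
by rewrite !nth_mkseq ?ww'.
Qed.

Lemma cyl_lword (w w' : lseq) n :
  cyl (lword w n) w' = (lword w' n = lword w n).
Proof. by rewrite /cyl /=; have -> : size (lword w n) = n by rewrite size_rev size_mkseq. Qed.

Lemma open_lseq (U : set lseq) w : open U -> U w ->
  exists n, cyl (lword w n) `<=` U.
Proof.
move=> oU Uw.
pose F := filter_from [set: nat]
  (fun n => [set w' : lseq | forall i, (i < n)%N -> w i = w' i]).
have FF : Filter F.
  apply: filter_from_filter; first by exists 0%N.
  move=> i j _ _; exists (maxn i j) => // w' H; split=> k ki; apply: H.
    by rewrite leq_max ki.
  by rewrite leq_max ki orbT.
have /pointwise_cvgP : forall t : nat, (g t @[g --> F] --> w t)%classic.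
  move=> t; apply/discrete_cvg; exists t.+1 => // w' /= H.
  by rewrite -H.
move=> /(_ U) [|n _ nU]; first by apply: open_nbhs_nbhs.
exists n => w' cw'; apply: nU; apply/lword_eqP.
by move: cw'; rewrite cyl_lword => ->.
Qed.

Lemma open_bigcup_cyl (U : set lseq) : open U ->
  U = \bigcup_(v in [set v | cyl v `<=` U]) cyl v.
Proof.
move=> oU; apply/seteqP; split=> [w Uw|w [v vU]]; last exact: vU.
have [n nU] := open_lseq oU Uw; exists (lword w n) => //.
by rewrite cyl_lword.
Qed.

Lemma cyl_open v : open (cyl v).
Proof.
rewrite openE => w cw.
have -> : cyl v = [set w' | forall i, (i < size v)%N -> w' i = w i].
  apply/seteqP; split => w'; rewrite /cyl /=.
    by rewrite -{2}cw => /lword_eqP.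
  by move=> H; rewrite -{2}cw; apply/lword_eqP => i; apply: H.
rewrite /interior; elim: (size v) => [|n IH].
  by apply: filterS filterT.
have := @proj_continuous nat (fun=> discrete_topology X) n w.
move=> /(_ [set w n] (discrete_set1 _)); rewrite nbhs_simpl => H.
near=> w' => i; rewrite ltnS leq_eqVlt => /predU1P[->|].
  by near: w'; exact: H.
by move: i; near: w'; exact: IH.
Unshelve. all: by end_near. Qed.

Section BernoulliExists.
Variable R : realType.
Local Notation q := #|X|.

Let q_gt0 : (0 < q)%N. Proof. by apply/card_gt0P; exists point. Qed.

(* The base-|X| expansion of a real number carries Lebesgue measure on [0, 1[ to
   the uniform Bernoulli measure. *)
Let letter (k : nat) : X := nth point (enum X) (k %% q).
Let digits (t : R) : lseq := fun n => letter (Num.truncn (t * q%:R ^+ n.+1)).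

Let Fixpoint decode (n k : nat) : seq X :=
  if n is n'.+1 then rcons (decode n' (k %/ q)) (letter k) else [::].

Let size_decode n k : size (decode n k) = n.
Proof. by elim: n k => //= n IH k; rewrite size_rcons IH. Qed.

Let truncn_divn (t : R) : (Num.truncn (t * q%:R) %/ q)%N = Num.truncn t.
Proof.
have q0 : 0 < q%:R :> R by rewrite ltr0n.
have [t0|t0] := leP 0 t; last first.
  have tn (s : R) : s < 0 -> Num.truncn s = 0%N.
    by move=> s0; apply/truncn0Pn; rewrite -ltNge (lt_trans s0).
  by rewrite !tn ?div0n// pmulr_llt0.
have tq0 : 0 <= t * q%:R by rewrite mulr_ge0 // ltW.
apply/eqP; rewrite eq_sym truncn_eq//; apply/andP; split.
  rewrite -(ler_pM2r q0) -natrM; apply: le_trans (_ : (Num.truncn (t * q%:R))%:R <= _).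
    by rewrite ler_nat leq_trunc_div.
  by rewrite truncn_le.
rewrite -(ltr_pM2r q0) -natrM; apply: lt_le_trans (truncnS_gt _) _.
by rewrite ler_nat -ltn_divLR.
Qed.

Let mkseq_digits t n :
  mkseq (digits t) n = decode n (Num.truncn (t * q%:R ^+ n)).
Proof.
elim: n => [//|n IH]; rewrite mkseqS IH /=; congr (rcons (decode _ _) _).
by rewrite exprSr mulrA truncn_divn.
Qed.

Let decode_bij n (v : seq X) : size v = n ->
  exists2 k, (k < q ^ n)%N & forall k', (k' < q ^ n)%N -> (decode n k' = v) <-> k' = k.
Proof.
elim: n v => [|n IH] v.
  by move=> /size0nil ->; exists 0%N => // k'; rewrite expn0 ltnS leqn0 => /eqP ->.
case/lastP: v => [//|v x]; rewrite size_rcons => -[/IH [k kn Hk]].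
have xq : (index x (enum X) < q)%N by rewrite cardE index_mem mem_enum.
exists (k * q + index x (enum X))%N.
  by rewrite expnSr (@leq_trans (k.+1 * q)) ?leq_pmul2r// mulSn addnC ltn_add2r.
move=> k' k'n; have k'qn : (k' %/ q < q ^ n)%N by rewrite ltn_divLR -?expnSr.
split=> [/= /eqP|->].
  rewrite eqseq_rcons => /andP[/eqP/(Hk _ k'qn) kE /eqP xE].
  rewrite (divn_eq k' q) kE -xE index_uniq ?enum_uniq// -cardE.
  exact: ltn_pmod.
rewrite /= divnMDl// divn_small// addn0 ((Hk k kn).2 erefl) /letter.
by rewrite modnMDl modn_small// nth_index ?mem_enum.
Qed.

Let measurable_truncn (P : set nat) (c : R) : measurable [set t : R | P (Num.truncn (t * c))].
Proof.
have mc : measurable_fun [set: R] (fun t : R => t * c) by exact: measurable_realfun.mulrr_measurable.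
have mle n : measurable [set t : R | (Num.truncn (t * c)%R <= n)%N].
  rewrite (_ : mkset _ = (fun t : R => t * c) @^-1` [set` `]-oo, n.+1%:R[]).
    by rewrite -[_ @^-1` _]setTI; apply: mc.
  by apply/seteqP; split=> t; rewrite /= in_itv /= truncn_le_nat.
rewrite (_ : mkset _ =
  \bigcup_(n in P) [set t : R | Num.truncn (t * c) = n]); last first.
  by apply/seteqP; split=> [t Pt|t [n Pn /= ->]//]; exists (Num.truncn (t * c)).
apply: bigcup_measurable => -[|n] _.
  rewrite (_ : mkset _ = [set t : R | (Num.truncn (t * c) <= 0)%N]); first exact: mle.
  by apply/seteqP; split=> t /=; rewrite leqn0 => /eqP.
rewrite (_ : mkset _ = [set t : R | (Num.truncn (t * c) <= n.+1)%N] `\`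
  [set t : R | (Num.truncn (t * c) <= n)%N]); first exact: measurableD.
apply/seteqP; split=> t /=; first by move=> ->; rewrite leqnn ltnn.
by move=> [] ? /negP; rewrite -ltnNge => ?; apply/eqP; rewrite eqn_leq; apply/andP.
Qed.

Let preimage_cyl v : digits @^-1` cyl v =
  [set t | decode (size v) (Num.truncn (t * q%:R ^+ size v)) = rev v].
Proof.
apply/seteqP; split=> t; rewrite /cyl /= /lword mkseq_digits; first by move/(canRL revK).
by move=> ->; rewrite revK.
Qed.

Let measurable_digits : measurable_fun [set: R] (digits : R -> borel lseq).
Proof.
apply: (@measurability _ _ _ (borel lseq) _ _ (@open lseq)) => // _ [U oU <-]; rewrite setTI.
rewrite (open_bigcup_cyl oU) preimage_bigcup bigcup_mkcond.
apply: countable_bigcupT_measurable => // v; case: ifP => // _.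
rewrite preimage_cyl; exact: (measurable_truncn [set k | _ k = _]).
Qed.


Let bern0 := pushforward (mrestr (@lebesgue_measure R) (measurable_itv `[0, 1[)) 
  (digits : R -> borel lseq).

Let bern0_cyl : uniform_bernoulli bern0.
Proof.
move=> v; rewrite /bern0 /pushforward /mrestr preimage_cyl.
have [k kn Hk] := decode_bij (size_rev v).
have qn0 : 0 < q%:R ^+ size v :> R by rewrite exprn_gt0 // ltr0n.
rewrite (_ : _ `&` _ = [set` `[k%:R / q%:R ^+ size v, k.+1%:R / q%:R ^+ size v[]).
  rewrite lebesgue_measure_itv /= lte_fin ltr_pM2r ?invr_gt0// ltr_nat leqnn.
  by rewrite -EFinB -mulrBl -natrB// subSnn mul1r.
apply/seteqP; split=> t /=; rewrite !in_itv /= ler_pdivrMr// ltr_pdivlMr//.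
  move=> [+ /andP[t0 t1]].
  have tq0 : 0 <= t * q%:R ^+ size v by rewrite mulr_ge0// ltW.
  have tqn : (Num.truncn (t * q%:R ^+ size v) < q ^ size v)%N.
    by rewrite truncn_lt_nat// natrX -[ltRHS]mul1r ltr_pM2r.
  by move=> /(Hk _ tqn)/eqP; rewrite truncn_eq.
move=> tk; have /truncn_def -> := tk; split; first exact/Hk.
move: tk => /andP[tk1 tk2]; apply/andP; split.
  by rewrite -(pmulr_lge0 _ qn0) (le_trans _ tk1).
by rewrite -(ltr_pM2r qn0) mul1r (lt_le_trans tk2)// -natrX ler_nat.
Qed.

Let bern0m : {measure set (borel lseq) -> \bar R} :=
  @measure_function_pushforward__canonical__measure_function_Measure
  _ _ _ _ _ (mrestr (@lebesgue_measure R) (measurable_itv `[0, 1[)) _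
  measurable_digits.

HB.instance Definition _ := isMeasure.Build _ _ _ bern0
  (measure0 bern0m) (measure_ge0 bern0m) (measure_semi_sigma_additive (s := bern0m)).

Let bern0T : bern0 setT = 1%E.
Proof.
rewrite (_ : setT = cyl [::]); first by rewrite bern0_cyl expr0 invr1.
by apply/seteqP; split.
Qed.

HB.instance Definition _ := Measure_isProbability.Build _ _ _ bern0 bern0T.

Lemma uniform_bernoulli_exists :
  exists P : probability (borel lseq) R, uniform_bernoulli P.
Proof. by exists bern0; exact: bern0_cyl. Qed.

End BernoulliExists.

Lemma uniform_bernoulli_unique (R : realType)
    (m1 m2 : {measure set (borel lseq) -> \bar R}) :
  uniform_bernoulli m1 -> uniform_bernoulli m2 ->
  forall A, measurable A -> m1 A = m2 A.
Proof.
move=> h1 h2; pose C : set (set (borel lseq)) := range cyl `|` [set set0].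
apply: (@measure_unique _ R _ C (fun=> setT)) => //.
- apply/seteqP; split; apply: smallest_sub => //.
  + move=> U oU; rewrite (open_bigcup_cyl oU) bigcup_mkcond.
    apply: (@countable_bigcupT_measurable _ (g_sigma_algebraType C)) => // v.
    case: ifP => _; last exact: (@measurable0 _ (g_sigma_algebraType C)).
    by apply: sub_gen_smallest; left; exists v.
  + exact: smallest_sigma_algebra.
  + move=> _ [[v _ <-]|->]; apply: sub_gen_smallest; [exact: cyl_open|exact: open0].
- have I u v : (size u <= size v)%N -> C (cyl u `&` cyl v).
    move=> uv; have [[w [wu wv]]|] := pselect (cyl u `&` cyl v !=set0); last first.
      by move=> /set0P/negP/negPn/eqP ->; right.
    left; exists v => //; apply/seteqP; split=> [w' w'v|w' []//]; split=> //.
    rewrite /cyl /= -[RHS]wu; apply/lword_eqP => i iu.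
    move: w'v; rewrite /cyl /= -[RHS]wv => /lword_eqP; apply.
    exact: leq_trans uv.
  move=> _ _ [[u _ <-]|->] [[v _ <-]|->]; rewrite ?setI0 ?set0I; do ?by right.
  by case: (leqP (size u) (size v)) => [|/ltnW] uv; [|rewrite setIC]; exact: I.
- by move=> _; left; exists [::] => //; apply/seteqP; split.
- by apply/seteqP; split=> // t _; exists 0%N.
- by move=> _ [[v _ <-]|->]; [rewrite h1 h2|rewrite !measure0].
- by move=> _ /=; rewrite (_ : setT = cyl [::]) ?h1 ?ltry//; apply/seteqP; split.
Qed.

Definition bernoulli (R : realType) : probability (borel lseq) R :=
  projT1 (cid (uniform_bernoulli_exists R)).

Lemma bernoulliE (R : realType) : uniform_bernoulli (bernoulli R).
Proof. exact: projT2 (cid (uniform_bernoulli_exists R)). Qed.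

End LeftInfinite.

(* G with the discrete topology, pointed at its unit. *)
Definition discG (G : groupType) : Type := discrete_topology G.
HB.instance Definition _ (G : groupType) := Choice.on (discG G).
HB.instance Definition _ (G : groupType) := Nbhs.on (discG G).
HB.instance Definition _ (G : groupType) := Uniform.on (discG G).
HB.instance Definition _ (G : groupType) := DiscreteTopology.on (discG G).
HB.instance Definition _ (G : groupType) := isPointed.Build (discG G) (1%g : G).

Section LimitSpace.
Variables (G : groupType) (X : pfinType) (a : selfsim G X).

Definition asym_equiv (p q : lseq X * discG G) : Prop :=
  exists2 K : set G, finite_set K &
  exists gs : nat -> G, forall n, (0 < n)%N ->
    [/\ K (gs n), a (gs n) (lword p.1 n) = lword q.1 n
      & (wsection a (gs n) (lword p.1 n) * p.2 = q.2)%g].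

Definition asym_rel p q := `[< asym_equiv p q >].

Let asym_refl : reflexive asym_rel.
Proof.
move=> p; apply/asboolP; exists [set 1%g]; first exact: finite_set1.
by exists (fun=> 1%g) => n _; rewrite act1 wsection1 mul1g.
Qed.

Let asym_equiv_sym p q : asym_equiv p q -> asym_equiv q p.
Proof.
move=> [K fK [gs H]]; exists [set g^-1%g | g in K]; first exact: finite_image.
exists (fun n => (gs n)^-1%g) => n /H[Kg pq2 qE]; split; first by exists (gs n).
  by rewrite -pq2 -actM mulVg act1.
by rewrite -pq2 wsectionV -qE mulKg.
Qed.

Let asym_sym : symmetric asym_rel.
Proof. by move=> p q; apply/asboolP/asboolP; exact: asym_equiv_sym. Qed.

Let asym_trans : transitive asym_rel.
Proof.
move=> q p r /asboolP[K fK [gs H]] /asboolP[K' fK' [gs' H']]; apply/asboolP.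
exists [set (g * h)%g | g in K' & h in K]; first exact: finite_image2.
exists (fun n => (gs' n * gs n)%g) => n n0; have [Kg pq qE] := H n n0.
have [Kg' qr rE] := H' n n0; split; first by exists (gs' n) => //; exists (gs n).
  by rewrite actM pq.
by rewrite wsectionM pq -mulgA qE.
Qed.

Definition asym_eqrel := EquivRel asym_rel asym_refl asym_sym asym_trans.

Definition limit_space : Type := quotient_topology {eq_quot asym_eqrel}%qT.
HB.instance Definition _ := Choice.on limit_space.
HB.instance Definition _ := Nbhs.on limit_space.
HB.instance Definition _ := Topological.on limit_space.

Definition limit_pi : lseq X * discG G -> limit_space := \pi_{eq_quot asym_eqrel}%qT.
HB.instance Definition _ := isPointed.Build limit_space (limit_pi (point, 1%g)).

Lemma limit_piP p q : limit_pi p = limit_pi q <-> asym_equiv p q.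
Proof. by split=> [/eqmodP/asboolP|pq] //; apply/eqmodP/asboolP. Qed.

Definition tile : set limit_space := limit_pi @` [set p | p.2 = 1%g].

Lemma measurable_limit_pi : measurable_fun setT
  (limit_pi : borel (lseq X) * borel (discG G) -> borel limit_space).
Proof.
apply: (@measurability _ _ _ (borel limit_space) _ _ (@open limit_space)) => //.
move=> _ [U oU <-]; rewrite setTI.
pose V : set (lseq X * discG G) := limit_pi @^-1` U.
have oV : open V by exact: oU.
have -> : limit_pi @^-1` U =
    \bigcup_v (cyl v `*` [set g | cyl v `*` [set g] `<=` V]).
  apply/seteqP; split=> [[w g] Vwg|[w g] [v _ [wv /(_ (w, g))]]]; last by apply.
  have oVg : open [set w | V (w, g)].
    rewrite openE => w' /= Vw'.
    have [[A B] [/= nA nB] AB] := open_nbhs_nbhs (conj oV Vw').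
    apply: filterS nA => w'' Aw''; apply: AB; split => //=.
    exact: nbhs_singleton nB.
  have [n nV] := open_lseq oVg Vwg; exists (lword w n) => //; split=> /=.
    by rewrite cyl_lword.
  by move=> [w' _] [/= /nV + ->].
apply: countable_bigcupT_measurable => // v; apply: measurableX.
  by apply: sub_gen_smallest; exact: cyl_open.
by apply: sub_gen_smallest; exact: discrete_open.
Qed.

(* With the integration order of \x^ this is the sum over g in G of the
   Bernoulli measures of the slices of the preimage at g. *)
Definition limit_measure (R : realType) : set (borel limit_space) -> \bar R :=
  pushforward (bernoulli X R \x^ @counting (borel (discG G)) R)%E
    (limit_pi : borel (lseq X) * borel (discG G) -> borel limit_space).

Section LimitMeasure.
Variable R : realType.

Let m : {measure set (borel limit_space) -> \bar R} :=
  measure_function_pushforward__canonical__measure_function_Measure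
    (bernoulli X R \x^ @counting (borel (discG G)) R)%E measurable_limit_pi.

HB.instance Definition _ := isMeasure.Build _ _ _ (limit_measure R)
  (measure0 m) (measure_ge0 m) (measure_semi_sigma_additive (s := m)).

End LimitMeasure.

End LimitSpace.
Arguments tile {G X} a _.
Arguments limit_measure {G X} a R _.

Record lgraph (V E L : Type) := LGraph {
  vset : set V; eset : set E; src : E -> V; tgt : E -> V; lab : E -> L }.

Definition relabel (V E L L' : Type) (f : L -> L') (Gam : lgraph V E L) :=
  LGraph (vset Gam) (eset Gam) (src Gam) (tgt Gam) (f \o lab Gam).

(* F_v; the edge e_(i + 1) of a left-infinite path ... e_2 e_1 is e i. *)
Definition path_labels (V E : Type) (X : pfinType) (Gam : lgraph V E X) (v : V) :
    set (lseq X) :=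
  [set w | exists e : nat -> E,
    [/\ forall i, eset Gam (e i), tgt Gam (e 0%N) = v,
        forall i, tgt Gam (e i.+1) = src Gam (e i)
      & forall i, lab Gam (e i) = w i]].

Definition meas (R : realType) (V : choiceType) (E : Type) (X : pfinType)
    (Gam : lgraph V E X) : \bar R :=
  (\sum_(v \in vset Gam) bernoulli X R (path_labels Gam v))%E.

Section Nucleus.
Variables (G : groupType) (X : pfinType) (a : selfsim G X) (N : set G).

(* The edge from g to g|_x is (g, x). *)
Definition nucleus_graph : lgraph G (G * X) (X * X) :=
  LGraph N [set e | N e.1] (fun e => e.1) (fun e => lsection a e.1 e.2)
    (fun e => (e.2, letter_act a e.1 e.2)).

Definition GammaN : lgraph G (G * X) X := relabel fst nucleus_graph.

Lemma GammaN_closed e : is_nucleus a N -> eset GammaN e ->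
  vset GammaN (src GammaN e) /\ vset GammaN (tgt GammaN e).
Proof. by move=> nN Ne; split=> //; exact: nucleus_lsection. Qed.

Lemma GammaN_deterministic e e' : src GammaN e = src GammaN e' ->
  lab GammaN e = lab GammaN e' -> e = e'.
Proof. by case: e e' => [g x] [h y] /= -> ->. Qed.

End Nucleus.

(* Main.v *)
(* The point of the left-infinite word w with group coordinate g lies in the tile
   iff g^-1 ends a left-infinite path of the nucleus labelled by w (Koenig's lemma,
   N being finite), so mu(T) is the sum of the measures of the sets F_v, i.e. the
   mean number of v with w in F_v.  For a given w this number is the eventual value
   of the cardinality of N|_(x_n ... x_1), which does not increase with n.  If k is
   the least cardinality of N|_u over all words u, attained at u0, then almost every
   w contains u0, so the number is almost surely k and mu(T) = k.  Since 1 is always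
   in N|_u, k = 1 means that a single word u sends all of N to 1; the open set
   condition produces such a word by killing the elements of N one after another. *)
Require Import Defs.
From HB Require Import structures.
From mathcomp Require Import all_boot all_order all_algebra finmap.
From mathcomp Require Import all_classical all_reals all_analysis.
From mathcomp Require Import measurable_realfun.

Set Implicit Arguments.
Unset Strict Implicit.
Unset Printing Implicit Defensive.

Import Order.TTheory GRing.Theory Num.Theory.

Local Open Scope classical_set_scope.
Local Open Scope ring_scope.

(** * Uniform bounds on finite sets, and integrals for the counting measure *)

(** The maximum of the individual bounds serves all. It provides the compactness in [core_pred] and
    the common contraction length in [uniform_contraction]. *)
Lemma finite_uniform_bound (T : choiceType) (A : set T) (P : T -> nat -> Prop) :
  finite_set A -> (forall x m n, (m <= n)%N -> P x m -> P x n) ->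
  (forall x, A x -> exists n, P x n) -> exists n, forall x, A x -> P x n.
Proof.
move=> fA mono ex.
have [f fP] : {f : T -> nat & forall x, A x -> P x (f x)}.
  apply: (@choice _ _ (fun x n => A x -> P x n)) => x.
  by have [/ex[n Pn]|nA] := pselect (A x); [exists n|exists 0%N].
exists (\max_(x <- fset_set A) f x)%N => x Ax.
apply: mono (fP x Ax); apply: leq_bigmax_seq => //.
by rewrite in_fset_set// inE.
Qed.

(** The function is the finite sum over [k] in [D] of [f k] times the indicator of [k], and each
    singleton has counting measure 1. *)
Lemma ge0_integral_counting_fin (d : measure_display) (T : measurableType d)
    (R : realType) (D : set T) (f : T -> \bar R) :
  finite_set D -> (forall x : T, measurable [set x]) ->
  (forall x, (0 <= f x)%E) -> (forall x, ~ D x -> f x = 0%E) ->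
  (\int[counting]_x f x = \sum_(x \in D) f x)%E.
Proof.
move=> fD mT f0 fD0.
pose g (k : T) : T -> \bar R := (cst (f k)) \_ [set k].
have gE k x : g k x = if x == k then f k else 0%E.
  by rewrite /g patchE; case: eqP => [->|xk]; [rewrite mem_set|rewrite memNset].
have -> : f = fun x => (\sum_(k \in D) g k x)%E.
  apply/funext => x; have [Dx|nDx] := pselect (D x); last first.
    rewrite fD0// fsbig1// => k Dk; rewrite gE; case: eqP => // xk.
    by move: nDx; rewrite xk.
  rewrite -(@fsbig_widen _ _ _ _ [set x]) ?fsbig_set1 ?gE ?eqxx//.
    by move=> _ ->.
  by move=> k [_ /= /eqP/negbTE kx]; rewrite gE eq_sym kx.
rewrite ge0_integral_fsum//.
- apply: eq_fsbigr => k /set_mem Dk; rewrite -integral_mkcond integral_cst//.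
  rewrite /= /counting; rewrite asboolT ?(finite_set1 k)//.
  rewrite fset_set1 cardfs1 mule1.
  rewrite -(@fsbig_widen _ _ _ _ [set k]) ?fsbig_set1 ?gE ?eqxx//.
    by move=> _ ->.
  by move=> i [_ /= /eqP/negbTE kx]; rewrite gE eq_sym kx.
- by move=> k; apply/(measurable_restrictT _ _).1; [exact: mT|exact: measurable_cst].
- by move=> k x _; rewrite gE; case: ifP.
Qed.

(** * Shift and finite endings of left-infinite words *)

Section Shift.
Variable X : pfinType.

(** Deletes the last letter x_1, which is [w 0]. *)
Definition lshift (w : lseq X) : lseq X := fun i => w i.+1.

Lemma size_lword (w : lseq X) n : size (lword w n) = n.
Proof. by rewrite size_rev size_mkseq. Qed.

Lemma lwordS (w : lseq X) n : lword w n.+1 = w n :: lword w n.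
Proof. by rewrite /lword mkseqS rev_rcons. Qed.

Lemma lwordSr (w : lseq X) n : lword w n.+1 = rcons (lword (lshift w) n) (w 0%N).
Proof. by elim: n => [//|n IH]; rewrite lwordS IH [in RHS]lwordS. Qed.

Lemma lwordD (w : lseq X) m n : exists2 u, size u = m & lword w (m + n) = u ++ lword w n.
Proof.
exists (take m (lword w (m + n))).
  by rewrite size_take size_lword; case: ltngtP => //; rewrite ltnNge leq_addr.
elim: m => [|m IH]; first by rewrite take0.
by rewrite addSn lwordS /= -IH.
Qed.

Lemma lword_level_open (P : seq X -> Prop) n : open [set w | P (lword w n)].
Proof.
rewrite (_ : mkset _ = \bigcup_(u in [set u | size u = n /\ P u]) cyl u).
  by apply: bigcup_open => u _; exact: cyl_open.
apply/seteqP; split=> [w Pw|w [u [<- Pu] /= ->]//].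
by exists (lword w n); rewrite ?cyl_lword//= size_lword.
Qed.

End Shift.

(** * The sets N|_u and the ends of left-infinite paths *)

Section Sections.
Variables (G : groupType) (X : pfinType) (a : selfsim G X) (N : set G).
Hypotheses (finN : finite_set N) (closedN : forall g x, N g -> N (lsection a g x)).

Definition sections (u : seq X) : {fset G} :=
  [fset wsection a g u | g in fset_set N]%fset.

Lemma sectionsP u v : reflect (exists2 g, N g & wsection a g u = v) (v \in sections u).
Proof.
apply: (iffP (imfsetP _ _ _ _)) => [[g /=]|[g Ng <-]].
  by rewrite in_fset_set// inE => Ng ->; exists g.
by exists g => //=; rewrite in_fset_set// inE.
Qed.

Lemma nucleus_wsection g u : N g -> N (wsection a g u).
Proof. by elim: u g => //= x u IH g Ng; apply: IH; exact: closedN. Qed.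

Lemma wsection_cat g u v : wsection a g (u ++ v) = wsection a (wsection a g u) v.
Proof. exact: foldl_cat. Qed.

(** N|_(uv) = (N|_u)|_v, and N|_u lies in N. *)
Lemma sections_catr u v : (sections (u ++ v) `<=` sections v)%fset.
Proof.
apply/fsubsetP => _ /sectionsP[g Ng <-]; rewrite wsection_cat.
by apply/sectionsP; exists (wsection a g u) => //; exact: nucleus_wsection.
Qed.

(** N|_(uv) is the image of N|_u under the map sending g to g|_v. *)
Lemma card_sections_catl u v : (#|` sections (u ++ v)| <= #|` sections u|)%N.
Proof.
apply: leq_trans (_ : #|` [fset wsection a g v | g in sections u]%fset| <= _)%N;
  last exact: leq_imfset_card.
apply/fsubset_leq_card/fsubsetP => _ /sectionsP[g Ng <-]; rewrite wsection_cat.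
by apply/imfsetP; exists (wsection a g u) => //=; apply/sectionsP; exists g.
Qed.

Lemma sections_lword w m n : (m <= n)%N ->
  (sections (lword w n) `<=` sections (lword w m))%fset.
Proof.
move=> /subnK <-; have [u _ ->] := lwordD w (n - m) m; exact: sections_catr.
Qed.

(* The vertices v of the nucleus with w in F_v, see path_labels_core. *)
Definition core (w : lseq X) : set G := [set v | forall n, v \in sections (lword w n)].

(* Koenig's lemma: the finite set N bounds the branching. *)
Lemma core_pred w v : core w v -> exists h, core (lshift w) h /\ lsection a h (w 0%N) = v.
Proof.
move=> cv; apply: contrapT => /forallNP nex.
(* If no predecessor of [v] is in the core, each one leaves the decreasing sets at some level; since
   N is finite, one level [n] excludes them all. *)
have [n nP] : exists n, forall h, N h -> lsection a h (w 0%N) = v ->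
    h \notin sections (lword (lshift w) n).
  apply: finite_uniform_bound => // [h m n mn hm hv|h Nh].
    by apply: contra (hm hv); apply/fsubsetP/sections_lword.
  have [hv|hv] := eqVneq (lsection a h (w 0%N)) v; last first.
    by exists 0%N => e; rewrite e eqxx in hv.
  have /existsNP[n nc] : ~ core (lshift w) h by move=> ch; apply: (nex h).
  by exists n => _; apply/negP.
(* The vertex reached just before the last letter is a predecessor of [v] still present at level
   [n]. *)
have /sectionsP[g Ng] := cv n.+1; rewrite lwordSr wsection_rcons => gv.
have := nP _ (nucleus_wsection (lword (lshift w) n) Ng) gv.
by move/negP; apply; apply/sectionsP; exists g.
Qed.

(** The first n edges of an infinite path exhibit [v] as a section by x_n ... x_1. Conversely,
    iterating a choice of predecessors from [core_pred] builds the infinite path. *)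
Lemma path_labels_core v : path_labels (GammaN a N) v = [set w | core w v].
Proof.
apply/seteqP; split=> [w [e [/= Ne e0 eS ew]] n|w cw].
  apply/sectionsP; case: n => [|n].
    by exists v => //; rewrite -e0; apply: closedN; exact: Ne.
  exists (e n).1; first exact: Ne.
  elim: n => [|n IH]; first by rewrite /wsection /= -[w 0%N]ew.
  by rewrite lwordS -[RHS]IH /wsection /= -[w n.+1]ew eS.
have [s sP] : {s : lseq X * G -> G & forall p, core p.1 p.2 ->
    core (lshift p.1) (s p) /\ lsection a (s p) (p.1 0%N) = p.2}.
  apply: (@choice _ _ (fun p h => core p.1 p.2 ->
    core (lshift p.1) h /\ lsection a h (p.1 0%N) = p.2)) => -[w' v'] /=.
  have [/core_pred[h hP]|nc] := pselect (core w' v'); first by exists h.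
  (* Default value off the core; by [cp] the iteration stays inside it. *)
  by exists 1%g.
pose st (p : lseq X * G) := (lshift p.1, s p).
pose p n := iter n st (w, v).
have cp n : core (p n).1 (p n).2 by elim: n => //= n IH; have [] := sP _ IH.
have pw n : (p n).1 0%N = w n.
  suff -> : (p n).1 = (fun i => w (n + i)%N) by rewrite addn0.
  by elim: n => //= n ->; apply/funext => i; rewrite /lshift addnS.
exists (fun n => ((p n.+1).2, w n)); split => //= [i| |i].
- have /sectionsP[g Ng] := cp i.+1 0%N; by move=> /= <-.
- by have [_] := sP _ (cp 0%N).
- by have [_] := sP _ (cp i.+1); rewrite pw.
Qed.

Lemma core_subset w : core w `<=` N.
Proof. by move=> v /(_ 0%N)/sectionsP[g Ng <-]. Qed.

End Sections.

(** * The preimage of the tile and its measure *)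

Section Tile.
Variables (G : groupType) (X : pfinType) (a : selfsim G X) (N : set G).
Hypothesis nucN : is_nucleus a N.

Let finN : finite_set N := nucN.1.1.
Let closedN g x : N g -> N (lsection a g x).
Proof. exact: nucleus_lsection. Qed.

Lemma uniform_contraction (K : set G) : finite_set K ->
  exists k, forall g, K g -> forall v, (k <= size v)%N -> N (wsection a g v).
Proof.
move=> fK; apply: finite_uniform_bound => // [g m n mn H v nv|g _].
  exact/H/(leq_trans mn).
exact: nucN.1.2.
Qed.

(** An equivalence of (w, g) with some (w', 1) means that g_n|_(x_n ... x_1) = g^-1 for all n >= 1,
    which explains the inverse. *)
Lemma tile_core (w : lseq X) (g : G) :
  tile a (limit_pi a (w, g)) <-> core a N w g^-1%g.
Proof.
split=> [[[w' _] /= -> /esym/limit_piP[K fK [s sP]]] n|cw].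
  have [k kP] := uniform_contraction fK.
  (* The k + 1 extra letters bring the section by [u] into N; the + 1 keeps the index positive when
     [n] is 0. *)
  have [u uk wE] := lwordD w k.+1 n.
  have [//|Ks _ /= sE] := sP (k.+1 + n)%N.
  apply/(sectionsP _ finN); exists (wsection a (s (k.+1 + n)%N) u).
    by apply: kP => //; rewrite uk.
  by move: sE; rewrite -wsection_cat -wE => /(canRL (mulgK _)); rewrite mul1g.
have : path_labels (GammaN a N) g^-1%g w by rewrite path_labels_core.
move=> [e [/= Ne e0 eS ew]].
(* The output letters along the path form the representative in the tile, and g_n is the start of
   the edge e_n, stored as [e n.-1]. *)
pose w' : lseq X := fun n => letter_act a (e n).1 (w n).
exists (w', 1%g) => //; apply/esym/limit_piP.
exists N => //; exists (fun n => (e n.-1).1) => -[//|n] _ /=.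
split; first exact: Ne.
- elim: n => [|n IH].
    by rewrite !lwordS act_cons act_nil.
  rewrite lwordS act_cons [RHS]lwordS; congr cons.
  by rewrite -IH -(eS n) ew.
- suff -> : wsection a (e n).1 (lword w n.+1) = g^-1%g by rewrite mulVg.
  elim: n => [|n IH]; first by rewrite /wsection /= -[w 0%N]ew.
  by rewrite lwordS -[RHS]IH /wsection /= -[w n.+1]ew eS.
Qed.

Lemma measurable_level (P : seq X -> Prop) n :
  measurable ([set w | P (lword w n)] : set (borel (lseq X))).
Proof. apply: sub_gen_smallest; exact: lword_level_open. Qed.

Lemma measurable_core v : measurable ([set w | core a N w v] : set (borel (lseq X))).
Proof.
rewrite (_ : mkset _ = \bigcap_n [set w | v \in sections a N (lword w n)]).
  apply: bigcapT_measurable => n.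
  exact: (measurable_level (fun u => v \in sections a N u)).
by apply/seteqP; split=> w cw n; [move=> _|]; exact: cw.
Qed.

(** The slice of the preimage at g is F_v for v = g^-1, empty if v is not in N; inversion reindexes
    the sum. *)
Lemma limit_measure_tile (R : realType) :
  limit_measure a R (tile a) = meas R (GammaN a N).
Proof.
rewrite /limit_measure /pushforward /product_measure2 /meas /=.
have secE (g : borel (discG G)) : ysection (limit_pi a @^-1` tile a) g =
    [set w | core a N w (g : G)^-1%g].
  by apply/seteqP; split=> w; rewrite ysectionE /=; apply tile_core.
rewrite (@ge0_integral_counting_fin _ (borel (discG G)) _ [set g^-1%g | g in N]) //=.
- rewrite (reindex_fsbig (fun g : G => g^-1%g : borel (discG G)) N) /=.
    apply: eq_fsbigr => v _; rewrite secE path_labels_core//; congr (bernoulli _ _ _).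
    by apply/seteqP; split=> w; rewrite /= invgK.
  split=> [g Ng|g h _ _|g [h Nh <-]] /=; [by exists g|exact: invg_inj|by exists h].
- exact: finite_image.
- by move=> g; apply: sub_gen_smallest; exact: discrete_open.
- move=> g nNg; rewrite secE (_ : mkset _ = set0) ?measure0//.
  rewrite -subset0 => w /core_subset-/(_ finN) Ng; apply: nNg.
  by exists (g : G)^-1%g; rewrite ?invgK.
Qed.

End Tile.

(** * The least rank is attained almost surely *)

Section Rank.
Variables (G : groupType) (X : pfinType) (a : selfsim G X) (N : set G).
Hypotheses (finN : finite_set N) (closedN : forall g x, N g -> N (lsection a g x)).
Variables (R : realType) (u0 : seq X).
Local Notation rk u := (#|` sections a N u|).
Local Notation k := (rk u0).
Hypothesis kmin : forall u, (k <= rk u)%N.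
Local Notation q := #|X|.

(** The cylinders of the words of length [n] satisfying [P] cover the set, each of measure
    |X|^-n. *)
Lemma bernoulli_level (P : pred (seq X)) n :
  (bernoulli X R [set w | P (lword w n)] <=
   (#|[set t : n.-tuple X | P t]%SET|%:R / q%:R ^+ n)%:E)%E.
Proof.
set B := [set t : n.-tuple X | P t]%SET.
have -> : (#|B|%:R / q%:R ^+ n)%:E =
    (\sum_(t \in [set` B]) bernoulli X R (cyl (t : seq X)))%E.
  rewrite (@fsbigE _ _ _ _ _ (enum B)) ?enum_uniq//=.
  - rewrite big_enum_cond /= (eq_bigl (fun t => t \in B)).
      under eq_bigr do rewrite bernoulliE size_tuple.
      by rewrite sumEFin sumr_const mulrC mulr_natr.
    by move=> t; rewrite mem_setE andbb.
  - by move=> t /=; rewrite mem_enum.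
  - by move=> t /=; rewrite mem_enum => ->.
apply: content_sub_fsum => //.
- by move=> t _; apply: sub_gen_smallest; exact: cyl_open.
- exact: (measurable_level P).
- move=> w Pw; exists (Tuple (introT eqP (size_lword w n))).
    by rewrite /= inE.
  by rewrite cyl_lword.
Qed.

Let bad n := [set t : n.-tuple X | (k < rk t)%N]%SET.

(* If the suffix of length n is already good, or the prefix is u0, so is the word. *)
Lemma card_badD n : (#|bad (size u0 + n)| <= (q ^ size u0).-1 * #|bad n|)%N.
Proof.
(* The factor counts the words of the length of [u0] other than [u0]. *)
have -> : (q ^ size u0).-1 = #|[set~ in_tuple u0]%SET|.
  by rewrite cardsC1 card_tuple.
rewrite -cardsX.
apply: leq_trans (leq_imset_card (fun p => cat_tuple p.1 p.2) _).
apply/subset_leq_card/fintype.subsetP => t; rewrite inE => tbad.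
have ts : size (take (size u0) t) = size u0.
  by rewrite size_take size_tuple; case: ltngtP => //; rewrite ltnNge leq_addr.
have td : size (drop (size u0) t) = n by rewrite size_drop size_tuple addKn.
have tE : take (size u0) t ++ drop (size u0) t = t by rewrite cat_take_drop.
apply/imsetP; exists (tcast ts (in_tuple (take (size u0) t)),
                      tcast td (in_tuple (drop (size u0) t))); last first.
  by apply: val_inj; rewrite /= !val_tcast /= tE.
rewrite !inE /= val_tcast; apply/andP; split.
  apply: contraTN tbad => /eqP/(congr1 (@tval _ _)); rewrite val_tcast /= => te.
  by rewrite -leqNgt -tE te; exact: card_sections_catl.
apply: leq_trans tbad _; rewrite -[X in (rk X <= _)%N]tE.
exact/fsubset_leq_card/sections_catr.
Qed.

(** Cut into [m] blocks of length |u0|, a bad word has no block equal to [u0]. *)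
Lemma card_bad m : (#|bad (m * size u0)| <= (q ^ size u0).-1 ^ m)%N.
Proof.
elim: m => [|m IH]; last first.
  by rewrite mulSn expnS (leq_trans (card_badD _))// leq_mul2l IH orbT.
by rewrite expn0 (leq_trans (max_card _))// card_tuple expn0.
Qed.

(** The exceptional set lies in the bad set at level m|u0| for every m, hence has measure at most
    c^m with c = 1 - |X|^-|u0| < 1. *)
Lemma ae_rank : {ae bernoulli X R, forall w, exists n, rk (lword w n) = k}.
Proof.
pose A := \bigcap_n [set w : lseq X | (k < rk (lword w n))%N].
have mA : measurable (A : set (borel (lseq X))).
  apply: bigcapT_measurable => n; exact: (measurable_level (fun u => k < rk u)%N).
exists A; split => //; last first.
  move=> w /= /forallNP nw n _ /=; rewrite ltn_neqAle kmin andbT.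
  by apply/eqP => e; exact: (nw n).
have q0 : (0 < q)%N by apply/card_gt0P; exists point.
set c : R := (q ^ size u0).-1%:R / q%:R ^+ size u0.
have c0 : 0 <= c by rewrite divr_ge0 ?exprn_ge0.
have c1 : c < 1.
  rewrite ltr_pdivrMr ?exprn_gt0 ?ltr0n// mul1r -natrX ltr_nat.
  by rewrite prednK ?expn_gt0 ?q0.
have Ac m : (bernoulli X R A <= (c ^+ m)%:E)%E.
  apply: (@le_trans _ _ (bernoulli X R [set w | (k < rk (lword w (m * size u0)))%N])).
    apply: le_measure; rewrite ?inE//.
      exact: (measurable_level (fun u => k < rk u)%N).
    by move=> w; exact.
  apply: le_trans (bernoulli_level (fun u => k < rk u)%N _) _.
  rewrite lee_fin /c expr_div_n -exprM [(size u0 * m)%N]mulnC ler_pM2r.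
    by rewrite -natrX ler_nat card_bad.
  by rewrite invr_gt0 exprn_gt0 ?ltr0n.
apply/eqP; rewrite eq_le measure_ge0 andbT; apply/lee_addgt0Pr => e e0.
rewrite add0e.
have normc : `|c| < 1 by rewrite ger0_norm.
have /cvgr0_norm_lt/(_ _ e0)[m _ /(_ m (leqnn m)) cm] := cvg_expr normc.
apply: le_trans (Ac m) _; rewrite lee_fin ltW//.
by rewrite ger0_norm ?exprn_ge0// in cm.
Qed.

(** The sets N|_(x_n ... x_1) decrease with n, so they are constant once the least cardinality is
    reached. *)
Lemma core_card w n : rk (lword w n) = k -> core a N w = [set` sections a N (lword w n)].
Proof.
move=> rn; apply/seteqP; split=> v /=; first exact.
move=> vn m; have [mn|/ltnW nm] := leqP m n.
  by apply: fsubsetP vn; apply: sections_lword.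
have /eqP -> // : sections a N (lword w m) == sections a N (lword w n).
by rewrite eqEfcard sections_lword// rn kmin.
Qed.

(** Exchanging sum and integral gives the mean of the number of elements of the core, which is
    almost surely [k] by [ae_rank] and [core_card]. *)
Lemma sum_core : (\sum_(v \in N) bernoulli X R [set w | core a N w v] = k%:R%:E)%E.
Proof.
transitivity (\int[bernoulli X R]_w \sum_(v \in N) (\1_[set w | core a N w v] w : R)%:E)%E.
  rewrite ge0_integral_fsum//.
  - apply: eq_fsbigr => v _; rewrite integral_indic ?setIT//.
    exact: measurable_core.
  - by move=> v; apply/measurable_EFinP/measurable_indic; exact: measurable_core.
transitivity (\int[bernoulli X R]_w (cst k%:R%:E) w)%E; last first.
  rewrite integral_cst// [X in (_ * X)%E](_ : _ = 1%E) ?mule1//; exact: probability_setT.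
apply: ge0_ae_eq_integral => //.
- apply: emeasurable_fsum => // v.
  by apply/measurable_EFinP/measurable_indic; exact: measurable_core.
- by move=> w _; apply: fsume_ge0.
- by move=> w _; rewrite lee_fin.
apply: filterS ae_rank; first exact: ae_filter_ringOfSetsType (bernoulli X R).
move=> w [n rn] _.
rewrite -rn.
have cw := core_card rn.
(* The indicators are 1 on these [k] vertices and 0 on the rest of N. *)
rewrite -(@fsbig_widen _ _ _ _ [set` sections a N (lword w n)]).
- rewrite fsbig_finite//= set_fsetK.
  rewrite (eq_big_seq (fun=> 1%:E)).
    by rewrite sumEFin big_const_seq count_predT iter_addr_0.
  by move=> v vs; rewrite indicE mem_set//= cw.
- by rewrite -cw; exact: core_subset.
- by move=> v [_ /= vn]; rewrite indicE memNset//= cw.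
Qed.

End Rank.

(** * Integrality and the open set condition *)

Theorem theorem11 (R : realType) (X : pfinType) (G : groupType)
    (a : selfsim G X) (N : set G) :
  contracting a -> is_nucleus a N ->
  [/\ limit_measure a R (tile a) = meas R (GammaN a N),
      exists z : int, limit_measure a R (tile a) = (z%:~R)%:E
    & limit_measure a R (tile a) = 1%E <-> open_set_condition a N].
Proof.
move=> _ nucN; have finN : finite_set N := nucN.1.1.
have closedN g x : N g -> N (lsection a g x) by exact: nucleus_lsection.
have N1 : N 1%g.
  (* Long sections of 1 lie in N, and they all equal 1. *)
  have [k /(_ (nseq k point))] := nucN.1.2 1%g.
  by rewrite size_nseq leqnn wsection1; apply.
have sections1 u : 1%g \in sections a N u.
  by apply/sectionsP => //; exists 1%g; rewrite ?wsection1.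
have [u0 kmin] : exists u0, forall u,
    (#|` sections a N u0| <= #|` sections a N u|)%N.
  have ex : exists n, `[< exists u, #|` sections a N u| = n >].
    by exists #|` sections a N [::]|; apply/asboolP; exists [::].
  case: (ex_minnP ex) => n /asboolP[u0 <-] nmin.
  by exists u0 => u; apply: nmin; apply/asboolP; exists u.
have tileE := limit_measure_tile nucN R.
have tilek : limit_measure a R (tile a) = (#|` sections a N u0|%:R)%:E.
  rewrite tileE -(sum_core finN closedN R kmin) /meas /=.
  by apply: eq_fsbigr => v _; rewrite path_labels_core.
split=> //; first by exists (#|` sections a N u0|%:Z); rewrite tilek.
rewrite tilek; split=> [[/eqP]|osc].
  (* A singleton containing 1 is {1}, so [u0] itself sends each g in N to 1. *)
  rewrite pnatr_eq1 => /cardfs1P[h hE] g Ng; exists u0.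
  have : wsection a g u0 \in sections a N u0 by apply/sectionsP => //; exists g.
  by have := sections1 u0; rewrite hE !in_fset1 => /eqP -> /eqP.
suff [u uP] : exists u, forall g, N g -> wsection a g u = 1%g.
  suff -> : #|` sections a N u0| = 1%N by []; apply/eqP; rewrite eqn_leq cardfs_gt0; apply/andP; split.
    apply: leq_trans (kmin u) _; rewrite -(cardfs1 (1%g : G)).
    apply/fsubset_leq_card/fsubsetP => _ /(sectionsP _ finN)[g Ng <-].
    by rewrite uP// in_fset1.
  by apply/fset0Pn; exists 1%g.
have [u uP] : exists u, forall g, g \in enum_fset (fset_set N) -> wsection a g u = 1%g.
  have sN : forall g, g \in enum_fset (fset_set N) -> N g.
    by move=> g; rewrite in_fset_set// inE.
  (* Given [u] for the tail, g|_u is still in N, so the condition gives [v] with g|_(uv) = 1;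
     elements already sent to 1 stay there since 1|_v = 1. *)
  elim: (enum_fset _) sN => [|g s IH] sN; first by exists [::].
  have [h hs|u uP] := IH; first by apply: sN; rewrite inE hs orbT.
  have [v vP] := osc (wsection a g u) (nucleus_wsection closedN u (sN g (mem_head _ _))).
  exists (u ++ v) => h; rewrite inE wsection_cat => /predU1P[->//|/uP ->].
  exact: wsection1.
by exists u => g Ng; apply: uP; rewrite in_fset_set// inE.
Qed.
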